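(* For every connected graph $G$ on $n$ vertices, the $\varphi$-quotient embedding algorithm with repair loop (described in the context), run with dimension cap $k_{\max}=n-1$, terminates and returns an isometric embedding of $G$ into $\mathrm{Cay}(\mathbb{Z}_2^k,S)$ with $k\leq n-1$.
   Context: Graphs are finite, simple, connected and undirected; $d_G$ is the shortest-path distance; an embedding $\lambda:V(G)\to\mathbb{Z}_2^k$ with generator set $S$ is isometric if $d_{\mathrm{Cay}}(\lambda(u),\lambda(v))=d_G(u,v)$ for all $u,v$, where $\mathrm{Cay}(\mathbb{Z}_2^k,S)$ is the graph on $\mathbb{Z}_2^k$ with edges $\{g,g+s\}$, $s\in S$. Quotient labeling of a partition. Given a partition $\mathcal{P}=\{F_1,\dots,F_t\}$ of $E(G)$, let $A[i,j]=|F_j\cap E(B_i)|\bmod 2$ for a cycle basis $B_1,\dots,B_c$ of $G$ (basis of the cycle space over $\mathbb{F}_2$), put $k=t-\mathrm{rank}_{\mathbb{F}_2}(A)$, let $g_j\in\mathbb{Z}_2^k$ be the image of the $j$-th standard basis vector under $\mathbb{Z}_2^t\to\mathbb{Z}_2^t/\mathrm{rowspan}(A)\cong\mathbb{Z}_2^k$, and let $\lambda(v)$ be the sum of the $g_j$ of the classes of the edges along any path from a fixed root to $v$. Algorithm. Initial partition: edges $\{u,v\},\{x,y\}$ are $\varphi$-related if $d(u,x)=d(v,y)$ and $d(u,y)=d(v,x)$; form the graph $\varphi(G)$ on $E(G)$ joining distinct $\varphi$-related edges; obtain $\mathcal{P}$ by repeatedly taking a largest connected component of the remaining graph, adding the whole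 component as a class if it is a clique and otherwise adding a maximum (or greedily found) clique of it as a class, and deleting the class. Then loop: (1) compute the quotient labeling $(k,\lambda,\{g_j\})$ of $\mathcal{P}$ and $S=\{g_j:g_j\neq\mathbf 0\}$; (2) if $k>k_{\max}$, return the quotient labeling of the all-singleton partition (the naive embedding, of dimension $n-1$); (3) compute $d_{\mathrm{Cay}}(\mathbf{0},\cdot)$ by breadth-first search truncated at depth $\mathrm{diam}(G)$, and the set $\mathcal{V}$ of pairs $(u,v)$ with $d_{\mathrm{Cay}}(\lambda(u),\lambda(v))\neq d_G(u,v)$; (4) if $\mathcal{V}=\emptyset$, return $(\lambda,k,S)$; (5) otherwise pick $(u^*,v^* )\in\mathcal{V}$ maximizing $d_G-d_{\mathrm{Cay}}$, take a geodesic word of generators summing to $\lambda(u^* )+\lambda(v^* )$, choose a largest class with at least two edges among the classes whose generators occur in that word (if none exists, a largest class with at least two edges), move one edge of it into a new singleton class, and repeat. *)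

(* Defs.v *)
From HB Require Import structures.
From mathcomp Require Import all_boot all_order all_algebra.
From Stdlib Require Export Relation_Operators.

Set Implicit Arguments.
Unset Strict Implicit.
Unset Printing Implicit Defensive.

Import Order.TTheory GRing.Theory Num.Theory.

Local Open Scope ring_scope.

Section Distance.
Variables (V : finType) (adj : rel V).

Definition walk_of_length (x y : V) (n : nat) : bool :=
  [exists p : n.-tuple V, path adj x p && (last x p == y)].

(* [None] stands for an infinite distance: a shortest walk has fewer than #|V| *)
(* edges.                                                                      *)
Definition dist (x y : V) : option nat :=
  let d := find (walk_of_length x y) (iota 0 #|V|) in
  if (d < #|V|)%N then Some d else None.

Definition diam : nat := \max_(x : V) \max_(y : V) odflt 0%N (dist x y).

Definition bfs_seen (x : V) (n : nat) : {set V} :=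
  iter n (fun A => A :|: [set z | [exists y in A, adj y z]]) [set x].

(* [None] when y is not discovered at depth r or less. *)
Definition bfs (r : nat) (x y : V) : option nat :=
  let d := find (fun i => y \in bfs_seen x i) (iota 0 r.+1) in
  if (d <= r)%N then Some d else None.

End Distance.

Definition cayley (k : nat) (S : {set 'rV['F_2]_k}) : rel 'rV['F_2]_k :=
  [rel x y | [exists s in S, y == x + s]].

Definition isometric (T : finType) (e : rel T) (k : nat)
    (lam : T -> 'rV['F_2]_k) (S : {set 'rV['F_2]_k}) : Prop :=
  forall u v : T, dist (cayley S) (lam u) (lam v) = dist e u v.

(* An edge is the 2-element set of its endpoints; a list of edge sets          *)
(* F_1, ..., F_t represents a partition of the edge set.                       *)
Notation edge T := {set T} (only parsing).
Notation classes T := (seq {set edge T}) (only parsing).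

Section Graph.
Variables (T : finType) (e : rel T).

Definition edges : {set edge T} :=
  [set f | [exists x, exists y, e x y && (f == [set x; y])]].

(* The condition does not depend on the order in which the endpoints of either *)
(* edge are listed.                                                            *)
Definition phi_rel : rel (edge T) :=
  [rel f h | [exists u, exists v, exists x, exists y,
    [&& f == [set u; v], h == [set x; y],
        dist e u x == dist e v y & dist e u y == dist e v x]]].

Definition phi_graph : rel (edge T) :=
  [rel f h | [&& f \in edges, h \in edges, f != h & phi_rel f h]].

Definition phi_components (R : {set edge T}) : {set {set edge T}} :=
  [set [set h | connect [rel a b | [&& a \in R, b \in R & phi_graph a b]] f h]
     | f in R].

Definition phi_clique (K : {set edge T}) : bool :=
  [forall f in K, forall h in K, (f != h) ==> phi_graph f h].

Definition maximum_clique (C K : {set edge T}) : Prop :=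
  [/\ K \subset C, phi_clique K &
      forall L : {set edge T}, L \subset C -> phi_clique L -> (#|L| <= #|K|)%N].

(* The vertices of C are scanned in an arbitrary order, each being kept if it  *)
(* is adjacent to all those already kept.                                      *)
Definition greedy_clique (C K : {set edge T}) : Prop :=
  exists2 s : seq (edge T), perm_eq s (enum C) &
    K = foldl (fun L f => if phi_clique (f |: L) then f |: L else L) set0 s.

Definition next_class (R K : {set edge T}) : Prop :=
  exists C : {set edge T},
    [/\ C \in phi_components R,
        forall D, D \in phi_components R -> (#|D| <= #|C|)%N &
        if phi_clique C then K = C
        else maximum_clique C K \/ greedy_clique C K].

Definition indicator (C : {set edge T}) : {ffun edge T -> ('F_2)^o} :=
  [ffun f => (f \in C)%:R].

Definition even_subgraph (C : {set edge T}) : bool :=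
  (C \subset edges) && [forall v, ~~ odd #|[set f in C | v \in f]|].

Definition cycle_space : {vspace {ffun edge T -> ('F_2)^o}} :=
  <<[seq indicator C | C <- enum [pred C | even_subgraph C]]>>%VS.

Definition cycle_basis (B : seq {set edge T}) : Prop :=
  basis_of cycle_space [seq indicator C | C <- B].

Section Labeling.
Variable P : classes T.

Definition cls (j : 'I_(size P)) : {set edge T} := nth set0 P j.

Definition parity_matrix (B : seq {set edge T}) :
    'M['F_2]_(size B, size P) :=
  \matrix_(i, j) (#|cls j :&: nth set0 B i|)%:R.

(* As f lies in exactly one class, the sum has a single term.                  *)
Definition edge_label k (g : 'I_(size P) -> 'rV['F_2]_k) (f : edge T) :
    'rV['F_2]_k :=
  \sum_(j | f \in cls j) g j.

Fixpoint walk_label k (g : 'I_(size P) -> 'rV['F_2]_k) (x : T) (p : seq T) :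
    'rV['F_2]_k :=
  if p is y :: q then edge_label g [set x; y] + walk_label g y q else 0.

(* Right multiplication by Q is a surjection Z_2^t -> Z_2^k with kernel        *)
(* rowspan(A), that is, the projection Z_2^t -> Z_2^t / rowspan(A) followed by *)
(* an isomorphism with Z_2^k; every cycle basis, isomorphism and root is       *)
(* allowed.                                                                    *)
Definition quotient_labeling (k : nat) (g : 'I_(size P) -> 'rV['F_2]_k)
    (lam : T -> 'rV['F_2]_k) : Prop :=
  exists B (Q : 'M['F_2]_(size P, k)) (root : T),
    let A := parity_matrix B in
    [/\ cycle_basis B,
        k = (size P - \rank A)%N,
        row_full Q && (kermx Q == A)%MS,
        forall j, g j = row j Q &
        forall p, path e root p -> lam (last root p) = walk_label g root p].

Definition generators k (g : 'I_(size P) -> 'rV['F_2]_k) : {set 'rV['F_2]_k} :=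
  [set g j | j : 'I_(size P) & g j != 0].

Definition largest_among (J : {set 'I_(size P)}) (j : 'I_(size P)) : Prop :=
  j \in J /\ forall i, i \in J -> (#|cls i| <= #|cls j|)%N.

Definition multi_edge_classes : {set 'I_(size P)} :=
  [set j | (1 < #|cls j|)%N].

Definition classes_in_word k (g : 'I_(size P) -> 'rV['F_2]_k)
    (w : seq 'rV['F_2]_k) : {set 'I_(size P)} :=
  [set j in multi_edge_classes | g j \in w].

Definition class_to_split k (g : 'I_(size P) -> 'rV['F_2]_k)
    (w : seq 'rV['F_2]_k) (j : 'I_(size P)) : Prop :=
  if classes_in_word g w == set0 then largest_among multi_edge_classes j
  else largest_among (classes_in_word g w) j.

Definition split_class (j : 'I_(size P)) (f : edge T) : classes T :=
  rcons (set_nth set0 P j (cls j :\ f)) [set f].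

End Labeling.

Definition singleton_classes (P : classes T) : Prop :=
  perm_eq P [seq [set f] | f <- enum edges].

Section Violations.
Variables (k : nat) (lam : T -> 'rV['F_2]_k) (S : {set 'rV['F_2]_k}).

Definition bfs_cayley (u v : T) : option nat :=
  bfs (cayley S) (diam e) 0 (lam u + lam v).

Definition violations : {set T * T} :=
  [set uv | bfs_cayley uv.1 uv.2 != dist e uv.1 uv.2].

(* An element not discovered by the truncated search is given the value        *)
(* diam(G) + 1.                                                                *)
Definition gap (uv : T * T) : int :=
  (odflt 0%N (dist e uv.1 uv.2))%:Z
  - (odflt (diam e).+1 (bfs_cayley uv.1 uv.2))%:Z.

Definition worst_violation (uv : T * T) : Prop :=
  uv \in violations /\ forall xy, xy \in violations -> gap xy <= gap uv.

Definition geodesic_word (h : 'rV['F_2]_k) (w : seq 'rV['F_2]_k) : Prop :=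
  [/\ {subset w <= S}, \sum_(s <- w) s = h &
      dist (cayley S) 0 h = Some (size w)].

End Violations.

(* [Building P R]: the classes P are formed and the edges R remain;            *)
(* [Repairing P]: the repair loop is entered with partition P;                 *)
(* [Returned lam S]: the algorithm has halted with this result.                *)
Inductive state : Type :=
| Building of classes T & {set edge T}
| Repairing of classes T
| Returned (k : nat) of (T -> 'rV['F_2]_k) & {set 'rV['F_2]_k}.

(* One step of the algorithm; the relation is not functional because ties and  *)
(* choices are left open.                                                      *)
Inductive step (kmax : nat) : state -> state -> Prop :=
| StepClass P R K of R != set0 & next_class R K :
    step kmax (Building P R) (Building (rcons P K) (R :\: K))
| StepLoop P :
    step kmax (Building P set0) (Repairing P)
| StepNaive P k (g : 'I_(size P) -> 'rV['F_2]_k) lam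
    P1 k1 (g1 : 'I_(size P1) -> 'rV['F_2]_k1) lam1
    of quotient_labeling g lam & (kmax < k)%N
     & singleton_classes P1 & quotient_labeling g1 lam1 :
    step kmax (Repairing P) (Returned lam1 (generators g1))
| StepReturn P k (g : 'I_(size P) -> 'rV['F_2]_k) lam
    of quotient_labeling g lam & (k <= kmax)%N
     & violations lam (generators g) = set0 :
    step kmax (Repairing P) (Returned lam (generators g))
| StepRepair P k (g : 'I_(size P) -> 'rV['F_2]_k) lam u v w j f
    of quotient_labeling g lam & (k <= kmax)%N
     & worst_violation lam (generators g) (u, v)
     & geodesic_word (generators g) (lam u + lam v) w
     & class_to_split g w j & f \in cls j :
    step kmax (Repairing P) (Repairing (split_class j f)).

Definition initial_state : state := Building [::] edges.

Definition reachable (kmax : nat) : state -> Prop :=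
  clos_refl_trans state (step kmax) initial_state.

Definition returns (s : state) : Prop :=
  exists k (lam : T -> 'rV['F_2]_k) S, s = Returned lam S.

(* Whatever the choices, no run is infinite, and a run can only stop by        *)
(* returning a result.                                                         *)
Definition terminates (kmax : nat) : Prop :=
  Acc (fun s' s => step kmax s s') initial_state /\
  forall s, reachable kmax s -> returns s \/ exists s', step kmax s s'.

End Graph.

(* Main.v *)
(* In every quotient labeling of a partition, each generator g_j equals lam *)
(* x + lam y for any edge {x, y} of the class F_j. Since lam vanishes at    *)
(* the root, the n - 1 other labels span Z_2^k, so k <= n - 1 at every      *)
(* iteration and the dimension cap never triggers. For the partition into   *)
(* singletons, the labeling is isometric: the cut between the vertices at   *)
(* distance at most i from u and the others meets every even subgraph in an *)
(* even number of edges, hence induces a functional on Z_2^k; the d(u, v)   *)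
(* cuts are pairwise disjoint, and each of them has to be crossed by some   *)
(* letter of a word representing lam u + lam v. Thus a violated pair is     *)
(* only found when some class has two edges, a repair step is then possible *)
(* and increases the number of classes, which is at most the number of      *)
(* edges; when no violated pair is left, the truncated search certifies     *)
(* isometry.                                                                *)

Require Import Defs.
From HB Require Import structures.
From mathcomp Require Import all_boot all_order all_algebra.
From mathcomp Require Import zify.

Set Implicit Arguments.
Unset Strict Implicit.
Unset Printing Implicit Defensive.

Import Order.TTheory GRing.Theory Num.Theory.

Local Open Scope ring_scope.

(** * Distances and breadth-first search *)

(** The algorithm is a nondeterministic relation [step], so the theorem reduces to an [invariant]
    kept by every step, a [variant] decreased by every step ([step_invariant]), and the possibility
    of a step from any non-returned state ([invariant_progress]).

    The rows of a parity matrix span the class vectors of all even subgraphs ([class_vec_sub],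
    [parity_matrix_sub]). Two walks with common ends differ by an even subgraph, so labels are well
    defined ([quotient_labeling_exists]). Dually, a functional on classes that kills even subgraphs
    descends to the quotient ([functional_lift]). Each generator is a sum of two labels and the root
    has label 0, whence [quotient_dim_le], which excludes the naive fallback.

    Labels never stretch distances ([cayley_dist_le]). If no class has two edges, the cuts bounding
    the balls around u descend to functionals which force a word for [lam u + lam v] to have at
    least d(u, v) letters ([word_size_ge]). A violation thus forces a class with two edges, which
    can be split; [partitions_size] bounds the number of splits. *)

Lemma find_iotaP (a : pred nat) n d :
  (if (find a (iota 0 n) < n)%N then Some (find a (iota 0 n)) else None)
    = Some d <->
  [/\ (d < n)%N, a d & forall m, (m < d)%N -> ~~ a m].
Proof.
split.
  case: ifP => // lt_n [] <-; split => // [|m m_lt].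
    have : has a (iota 0 n) by rewrite has_find size_iota.
    by move/(nth_find 0%N); rewrite nth_iota.
  have m_n := ltn_trans m_lt lt_n.
  by move/(before_find 0%N): m_lt; rewrite nth_iota // => ->.
case=> dn ad min_d; suff -> : find a (iota 0 n) = d by rewrite dn.
have hasd : has a (iota 0 n).
  by apply/hasP; exists d => //; rewrite mem_iota.
have fn := hasd; rewrite has_find size_iota in fn.
have := nth_find 0%N hasd; rewrite nth_iota // add0n => af.
apply/eqP; rewrite eqn_leq; apply/andP; split; rewrite leqNgt; apply/negP.
  by move/(before_find 0%N); rewrite nth_iota // add0n ad.
by move/min_d; rewrite af.
Qed.

Section Distance.
Variables (V : finType) (adj : rel V).

Lemma walk_of_lengthP x y n :
  reflect (exists p, [/\ path adj x p, last x p = y & size p = n])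
    (walk_of_length adj x y n).
Proof.
apply: (iffP existsP) => [[p /andP[xp /eqP py]] | [p [xp py /eqP sp]]].
  by exists p; rewrite size_tuple.
by exists (Tuple sp); rewrite /= xp py eqxx.
Qed.

Lemma distP x y d :
  dist adj x y = Some d <->
  walk_of_length adj x y d /\
  forall m, (m < d)%N -> ~~ walk_of_length adj x y m.
Proof.
rewrite find_iotaP; split=> [[] //|[wd min_d]]; split => //.
rewrite ltnNge; apply/negP => Vd.
have [p [xp py sp]] := walk_of_lengthP _ _ _ wd.
(* Removing repeated vertices leaves fewer than [#|V|] edges, against the minimality of [d]. *)
case/shortenP: xp py => q xq uq _ qy.
have : (size q < #|V|)%N.
  by have := max_card (mem (x :: q)); rewrite (card_uniqP uq).
move=> /leq_trans/(_ Vd)/min_d/walk_of_lengthP[].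
by exists q.
Qed.

Lemma dist_exists x y n :
  walk_of_length adj x y n -> exists2 d, dist adj x y = Some d & (d <= n)%N.
Proof.
move=> wn; have [|d wd min_d] := @ex_minnP (walk_of_length adj x y).
  by exists n.
exists d; last exact: min_d.
by apply/distP; split => // m; rewrite ltnNge; apply: contra => /min_d.
Qed.

Lemma bfs_seenP x n y :
  reflect (exists2 m, (m <= n)%N & walk_of_length adj x y m)
    (y \in bfs_seen adj x n).
Proof.
elim: n y => [|n IH] y.
  rewrite /bfs_seen /= inE; apply: (iffP eqP) => [->|[m]].
    by exists 0%N => //; apply/walk_of_lengthP; exists [::].
  rewrite leqn0 => /eqP-> /walk_of_lengthP[p [_ <- /size0nil->]] //.
rewrite /bfs_seen iterS -/(bfs_seen adj x n) !inE.
apply: (iffP orP) => [[/IH[m mn w]|/exists_inP[z /IH[m mn]]] | [m]].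
- by exists m => //; apply: leqW.
- move=> /walk_of_lengthP[p [xp pz sp]] zy; exists m.+1 => //.
  apply/walk_of_lengthP; exists (rcons p y).
  by rewrite rcons_path xp pz last_rcons size_rcons sp.
rewrite leq_eqVlt => /orP[/eqP->|mn w]; last by left; apply/IH; exists m.
case/walk_of_lengthP=> p; case/lastP: p => [|p z] [] //.
rewrite rcons_path last_rcons size_rcons => /andP[xp pz] <- [sp]; right.
apply/exists_inP; exists (last x p) => //; apply/IH; exists n => //.
by apply/walk_of_lengthP; exists p.
Qed.

Lemma bfs_dist r x y d :
  bfs adj r x y = Some d <-> dist adj x y = Some d /\ (d <= r)%N.
Proof.
rewrite /bfs -ltnS find_iotaP distP ltnS; split.
  case=> dr /bfs_seenP[m md wm] min_d; split=> //.
  have nw i : (i < d)%N -> ~~ walk_of_length adj x y i.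
    by move=> /min_d; apply: contra => w; apply/bfs_seenP; exists i.
  split=> //; move: md; rewrite leq_eqVlt => /orP[/eqP <- //|/nw].
  by rewrite wm.
case=> [[wd min_d] dr]; split => //; first by apply/bfs_seenP; exists d.
move=> m md; apply/bfs_seenP => -[i im].
by apply/negP/min_d/(leq_ltn_trans im).
Qed.

End Distance.

(** * Arithmetic in characteristic 2 *)

Section Characteristic2.

Lemma F2_pchar : 2%N \in [pchar 'F_2].
Proof. exact: pchar_Fp. Qed.

Lemma F2_addrr (V : lmodType 'F_2) (v : V) : v + v = 0.
Proof.
by rewrite -[v in LHS]scale1r -scalerDl (addrr_pchar2 F2_pchar) scale0r.
Qed.

Lemma F2_oppr (V : lmodType 'F_2) (v : V) : - v = v.
Proof. by apply/eqP; rewrite eq_sym -addr_eq0 F2_addrr. Qed.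

Lemma F2_natr_odd n : (odd n)%:R = n%:R :> 'F_2.
Proof.
by rewrite -[in RHS](odd_double_half n) natrD -addnn natrD
  (addrr_pchar2 F2_pchar) addr0.
Qed.

Lemma F2_natr_eq0 n : (n%:R == 0 :> 'F_2) = ~~ odd n.
Proof. by rewrite -F2_natr_odd; case: (odd n). Qed.

Lemma F2_mulrn_odd (V : lmodType 'F_2) (v : V) n : v *+ n = v *+ odd n.
Proof. by rewrite -scaler_nat -F2_natr_odd scaler_nat. Qed.

End Characteristic2.

(** * Words and distances in Cayley graphs *)

Section Cayley.
Variables (k : nat) (S : {set 'rV['F_2]_k}).

Lemma cayley_walkP (x y : 'rV['F_2]_k) n :
  walk_of_length (cayley S) x y n <->
  exists w : seq 'rV['F_2]_k,
    [/\ {subset w <= S}, y = x + \sum_(s <- w) s & size w = n].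
Proof.
split=> [/walk_of_lengthP[p []]|[w]].
  elim: p x n => [|z p IH] x n /= => [_ <- <-|].
    by exists [::]; split => //; rewrite big_nil addr0.
  move=> /andP[/exists_inP[s sS /eqP xz] zp] py; case: n => // n [sp].
  have [w [wS -> sw]] := IH _ _ zp py sp.
  exists (s :: w); rewrite /= sw big_cons xz addrA; split => // t.
  by rewrite inE => /predU1P[->|/wS].
elim: w x n => [|s w IH] x n [wS def_y <-].
  rewrite def_y.
  by apply/walk_of_lengthP; exists [::]; rewrite big_nil addr0.
have /walk_of_lengthP[p [xp py sp]] :
    walk_of_length (cayley S) (x + s) y (size w).
  apply: IH; split=> // [t tw|]; first by apply: wS; rewrite inE tw orbT.
  by rewrite def_y big_cons addrA.
apply/walk_of_lengthP; exists (x + s :: p).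
rewrite /= xp py sp; split => //; rewrite andbT.
by apply/exists_inP; exists s => //; apply: wS; rewrite mem_head.
Qed.

Lemma cayley_walk0 (x y : 'rV['F_2]_k) n :
  walk_of_length (cayley S) x y n = walk_of_length (cayley S) 0 (x + y) n.
Proof.
apply/idP/idP => /cayley_walkP[w [wS def_y sw]]; apply/cayley_walkP;
  exists w; split=> //.
  by rewrite def_y addrA F2_addrr add0r.
by rewrite add0r in def_y; rewrite -def_y addrA F2_addrr add0r.
Qed.

Lemma cayley_dist0 (x y : 'rV['F_2]_k) d :
  dist (cayley S) x y = Some d <-> dist (cayley S) 0 (x + y) = Some d.
Proof.
have W := cayley_walk0 x y.
split=> /distP[wd min_d]; apply/distP; split=> [|m /min_d].
- by rewrite -W.
- by rewrite -W.
- by rewrite W.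
- by rewrite W.
Qed.

End Cayley.

(** * Walks and the cycle space *)

Lemma span_ind (K : fieldType) (vT : vectType K) (P : vT -> Prop) X v :
  P 0 -> (forall a u w, P u -> P w -> P (a *: u + w)) ->
  {in X, forall u, P u} -> v \in <<X>>%VS -> P v.
Proof.
move=> P0 Plin; elim: X v => [|x X IH] v PX.
  by rewrite span_nil memv0 => /eqP->.
rewrite span_cons => /memv_addP[_ /vlineP[a ->] [w Xw ->]].
apply: Plin; first by apply: PX; rewrite mem_head.
by apply: IH Xw => u uX; apply: PX; rewrite inE uX orbT.
Qed.

(** A cycle basis is a list of edge sets rather than of vectors, so the basis has to consist of
    values of [F]. *)
Lemma basis_of_map (K : fieldType) (vT : vectType K) (I : Type) (F : I -> vT)
    (s : seq I) :
  exists s', basis_of <<[seq F i | i <- s]>>%VS [seq F i | i <- s'].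
Proof.
elim: s => [|i s [s' /andP[/eqP span_s' free_s']]].
  by exists [::]; rewrite /basis_of nil_free eqxx.
have [Fi|Fi] := boolP (F i \in <<[seq F i | i <- s']>>%VS); last first.
  exists (i :: s').
  by rewrite /basis_of /= free_cons Fi !span_cons span_s' eqxx.
exists s'; rewrite /basis_of free_s' span_s' /= span_cons andbT.
by rewrite eqEsubv addvSr subv_add subvv andbT -memvE -span_s' Fi.
Qed.

Section WalkEdges.
Variables (T : finType) (e : rel T).
Hypothesis e_irr : irreflexive e.
Implicit Types (f : {set T}) (s : seq {set T}) (B C : {set {set T}}).

Fixpoint walk_edges (x : T) (p : seq T) : seq {set T} :=
  if p is y :: q then [set x; y] :: walk_edges y q else [::].

Lemma edgesP f :
  reflect (exists x y, e x y /\ f = [set x; y]) (f \in edges e).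
Proof.
rewrite inE; apply: (iffP existsP) => -[x].
  by case/existsP=> y /andP[xy /eqP ->]; exists x, y.
by case=> y [xy ->]; exists x; apply/existsP; exists y; rewrite xy /=.
Qed.

Lemma walk_edges_sub x p : path e x p -> {subset walk_edges x p <= edges e}.
Proof.
elim: p x => //= y p IH x /andP[xy /IH yp] f.
by rewrite inE => /predU1P[->|/yp//]; apply/edgesP; exists x, y.
Qed.

(** The sum modulo 2 of a list of edges: repeated edges cancel in pairs. *)
Definition odd_edges s : {set {set T}} := [set f | odd (count_mem f s)].

Lemma sum_odd_edges (V : lmodType 'F_2) (F : {set T} -> V) s :
  \sum_(f in odd_edges s) F f = \sum_(f <- s) F f.
Proof.
transitivity (\sum_f F f *+ count_mem f s).
  rewrite big_mkcond; apply: eq_bigr => f _.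
  by rewrite F2_mulrn_odd inE; case: odd.
elim: s => [|h s IH]; first by rewrite big_nil big1.
rewrite big_cons -IH /=; under eq_bigr do rewrite mulrnDr.
rewrite big_split /= (bigD1 h) //= eqxx big1 ?addr0 // => f /negPf.
by rewrite eq_sym => ->.
Qed.

(** The coboundary of [L]: on an edge it is 1 exactly when the edge crosses the cut between [L] and
    its complement. *)
Definition incidence (L : {set T}) f : 'F_2 := \sum_(v in f) (v \in L)%:R.

Lemma incidence_edge L x y :
  e x y -> incidence L [set x; y] = (x \in L)%:R + (y \in L)%:R.
Proof.
move=> xy; rewrite /incidence big_setU1 ?big_set1 // inE.
by apply: contraTneq xy => ->; rewrite e_irr.
Qed.

Lemma sum_incidence_walk L x p : path e x p ->
  \sum_(f <- walk_edges x p) incidence L f = (x \in L)%:R + (last x p \in L)%:R.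
Proof.
elim: p x => [|y p IH] x /=.
  by rewrite big_nil (addrr_pchar2 F2_pchar).
case/andP=> xy /IH yp; rewrite big_cons yp incidence_edge // addrA.
by rewrite -[X in X + _]addrA (addrr_pchar2 F2_pchar) addr0.
Qed.

Lemma sum_incidence L B :
  \sum_(f in B) incidence L f
    = \sum_(v in L) #|[set f in B | v \in f]|%:R :> 'F_2.
Proof.
rewrite /incidence (exchange_big_dep predT) //= [RHS]big_mkcond.
apply: eq_bigr => v _; rewrite -sum1_card natr_sum.
case: (v \in L); last by rewrite big1.
by apply: eq_bigl => f; rewrite inE.
Qed.

Lemma even_subgraph_incidence L B :
  even_subgraph e B -> \sum_(f in B) incidence L f = 0.
Proof.
case/andP=> _ /forallP even_B; rewrite sum_incidence big1 // => v _.
by apply/eqP; rewrite F2_natr_eq0.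
Qed.

Lemma even_subgraph_odd_edges s :
  {subset s <= edges e} ->
  (forall v, \sum_(f <- s) incidence [set v] f = 0) ->
  even_subgraph e (odd_edges s).
Proof.
move=> s_edges s0; apply/andP; split.
  apply/subsetP=> f; rewrite inE => fs; apply/s_edges.
  by rewrite -has_pred1 has_count; case: count fs.
apply/forallP=> v; rewrite -F2_natr_eq0 -(s0 v).
by rewrite -(sum_odd_edges (V := ('F_2)^o)) sum_incidence big_set1.
Qed.

Section Labels.
Variables (P : seq {set {set T}}) (k : nat) (g : 'I_(size P) -> 'rV['F_2]_k).

Lemma walk_labelE x p :
  walk_label g x p = \sum_(f <- walk_edges x p) edge_label g f.
Proof. by elim: p x => [|y p IH] x /=; rewrite ?big_nil // big_cons IH. Qed.

Lemma walk_label_rcons x p y : walk_label g x (rcons p y)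
  = walk_label g x p + edge_label g [set last x p; y].
Proof.
elim: p x => [|z p IH] x /=; first by rewrite addr0 add0r.
by rewrite IH addrA.
Qed.

Definition class_vec C : 'rV['F_2]_(size P) := \row_j #|cls j :&: C|%:R.

(** The class vector is linear in the indicator, its entries being sums of the indicator over the
    classes. *)
Lemma class_vec_span m (A : 'M_(m, size P)) (s : seq {set {set T}}) C :
  {in s, forall D, class_vec D <= A}%MS ->
  indicator C \in <<[seq indicator D | D <- s]>>%VS -> (class_vec C <= A)%MS.
Proof.
move=> sA.
pose vec (u : {ffun {set T} -> ('F_2)^o}) : 'rV['F_2]_(size P) :=
  \row_j \sum_(f in cls j) u f.
have vecE D : class_vec D = vec (indicator D).
  apply/rowP=> j; rewrite !mxE -sum1_card natr_sum /=.
  rewrite big_mkcond [RHS]big_mkcond; apply: eq_bigr => f _.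
  by rewrite ffunE inE; case: (f \in cls j); case: (f \in D).
rewrite vecE; apply: (span_ind (P := fun u => (vec u <= A)%MS)).
- rewrite (_ : vec 0 = 0) ?sub0mx //; apply/rowP=> j.
  by rewrite !mxE big1 // => f _; rewrite ffunE.
- move=> a u w uA wA; rewrite (_ : vec _ = a *: vec u + vec w).
    by rewrite addmx_sub ?scalemx_sub.
  apply/rowP=> j; rewrite !mxE mulr_sumr -big_split.
  by apply: eq_bigr => f _; rewrite !ffunE.
by move=> _ /mapP[D /sA DA ->]; rewrite -vecE.
Qed.

Lemma parity_matrixE (B : seq {set {set T}}) i :
  row i (parity_matrix P B) = class_vec (nth set0 B i).
Proof. by apply/rowP=> j; rewrite !mxE. Qed.

Lemma class_vec_sub (B : seq {set {set T}}) C :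
  cycle_basis e B -> even_subgraph e C ->
  (class_vec C <= parity_matrix P B)%MS.
Proof.
move=> /andP[/eqP span_B _] even_C; apply: (class_vec_span (s := B)).
  move=> D DB; have iB : (index D B < size B)%N by rewrite index_mem.
  by rewrite -(nth_index set0 DB) -(parity_matrixE (Ordinal iB)) row_sub.
rewrite span_B; apply: memv_span; apply/mapP; exists C => //.
by rewrite mem_enum.
Qed.

(** Members of [B] are given only through their indicators lying in the cycle space, so the argument
    passes through the span of all even subgraphs. *)
Lemma parity_matrix_sub m (A : 'M_(m, size P)) (B : seq {set {set T}}) :
  cycle_basis e B -> (forall C, even_subgraph e C -> (class_vec C <= A)%MS) ->
  (parity_matrix P B <= A)%MS.
Proof.
move=> /andP[/eqP span_B _] even_A; apply/row_subP=> i; rewrite parity_matrixE.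
apply: (class_vec_span (s := enum [pred C | even_subgraph e C])).
  by move=> C; rewrite mem_enum => /even_A.
rewrite -/(cycle_space e) -span_B; apply: memv_span.
by apply/map_f/mem_nth.
Qed.

Lemma class_vec_mul (Q : 'M['F_2]_(size P, k)) C :
  class_vec C *m Q = \sum_(f in C) edge_label (fun j => row j Q) f.
Proof.
rewrite mulmx_sum_row /edge_label (exchange_big_dep predT) //=.
apply: eq_bigr => j _; rewrite mxE scaler_nat.
rewrite -sumr_const; apply: eq_bigl => f.
by rewrite inE andbC.
Qed.

End Labels.
End WalkEdges.

(** * Quotient labelings *)

Section QuotientLabeling.
Variables (T : finType) (e : rel T).
Hypotheses (e_sym : symmetric e) (e_irr : irreflexive e).
Hypothesis e_conn : forall x y : T, connect e x y.
Implicit Types (f : {set T}) (P : seq {set {set T}}) (R C : {set {set T}}).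

Lemma dist_conn u v : exists2 d, dist e u v = Some d & (d <= diam e)%N.
Proof.
have /connectP[p up ->] := e_conn u v.
have [|d uv_d _] := @dist_exists _ e u (last u p) (size p).
  by apply/walk_of_lengthP; exists p.
exists d => //; rewrite /diam.
apply: leq_trans (leq_bigmax_cond u isT).
by apply: leq_trans (leq_bigmax_cond (last u p) isT); rewrite uv_d.
Qed.

Lemma quotient_labeling_exists P : (0 < #|T|)%N ->
  exists k (g : 'I_(size P) -> 'rV['F_2]_k) lam, quotient_labeling e g lam.
Proof.
case/card_gt0P=> root _.
have [B basis_B] :=
  basis_of_map (@indicator T) (enum [pred C | even_subgraph e C]).
(* The square matrix [cokermx A] has the right kernel; its column base keeps that kernel with only
   [size P - \rank A] columns. *)
pose A := parity_matrix P B; pose Q := col_base (cokermx A).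
pose g j := row j Q.
have kerQ : (kermx Q == A)%MS.
  have coker_eq0 m (u : 'M_(m, _)) : (u *m Q == 0) = (u <= A)%MS.
    rewrite submxE -[in RHS](mulmx_base (cokermx A)) mulmxA -/Q.
    by rewrite (mulmx_free_eq0 _ (row_base_free _)).
  apply/andP; split; first by rewrite -coker_eq0 mulmx_ker.
  by apply/sub_kermxP/eqP; rewrite coker_eq0.
have walk_label_last p q : path e root p -> path e root q ->
    last root p = last root q -> walk_label g root p = walk_label g root q.
  move=> rp rq pq; apply/eqP; rewrite -subr_eq0 F2_oppr; apply/eqP.
  rewrite !walk_labelE -big_cat /= -sum_odd_edges -class_vec_mul.
  apply/sub_kermxP; rewrite (eqmxP kerQ); apply: class_vec_sub basis_B _.
  apply: even_subgraph_odd_edges => [f|v].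
    by rewrite mem_cat => /orP[]; apply: walk_edges_sub.
  rewrite big_cat /= !(sum_incidence_walk e_irr) // pq.
  exact: addrr_pchar2 F2_pchar _.
have paths v : exists p, path e root p && (last root p == v).
  by have /connectP[p rp ->] := e_conn root v; exists p; rewrite rp eqxx.
exists _, g, (fun v => walk_label g root (xchoose (paths v))), B, Q, root.
split=> // [||p rp].
- by rewrite mxrank_coker.
- by rewrite kerQ andbT col_base_full.
have /andP[rq /eqP pq] := xchooseP (paths (last root p)).
exact: walk_label_last.
Qed.

Section Labeled.
Variables (P : seq {set {set T}}) (k : nat) (g : 'I_(size P) -> 'rV['F_2]_k).
Variable lam : T -> 'rV['F_2]_k.
Hypothesis g_lam : quotient_labeling e g lam.

Lemma lam_edge x y : e x y -> lam x + lam y = edge_label g [set x; y].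
Proof.
case: g_lam => B [Q [root [_ _ _ _ lam_last]]] xy.
have /connectP[p rp def_x] := e_conn root x.
have rpy : path e root (rcons p y) by rewrite rcons_path rp -def_x.
move: (lam_last _ rp) (lam_last _ rpy).
rewrite last_rcons walk_label_rcons -def_x => -> ->.
by rewrite addrA F2_addrr add0r.
Qed.

Lemma lam_walk x p : path e x p -> lam x + lam (last x p) = walk_label g x p.
Proof.
elim: p x => [|y p IH] x /=; first by rewrite F2_addrr.
case/andP=> /lam_edge <- /IH <-.
by rewrite addrA -[lam x + lam y + _]addrA F2_addrr addr0.
Qed.

(* The kernel of the quotient map is the row span of the parity matrix, so a *)
(* functional on classes that vanishes on even subgraphs factors through it. *)
Lemma functional_lift (h : 'I_(size P) -> 'F_2) :
  (forall B, even_subgraph e B ->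
     \sum_j #|cls j :&: B|%:R * h j = 0) ->
  exists r : 'cV['F_2]_k, forall j, (g j *m r) 0 0 = h j.
Proof.
case: g_lam => B [Q [root [basis_B _ /andP[Q_full /eqmxP kerQ] gE _]]] h0.
pose H : 'cV['F_2]_(size P) := \col_j h j.
have A0 : parity_matrix P B *m H = 0.
  apply/sub_kermxP/(parity_matrix_sub basis_B) => C /h0 hC.
  apply/sub_kermxP/matrixP=> i j; rewrite !mxE -[RHS]hC.
  by apply: eq_bigr => l _; rewrite !mxE.
(* [Q] kills [Q *m pinvmx Q - 1], whose rows therefore lie in the row span of the parity matrix,
   which [H] annihilates. *)
exists (pinvmx Q *m H) => j.
suff QH : Q *m (pinvmx Q *m H) = H by rewrite gE -row_mul QH !mxE.
apply/eqP; rewrite mulmxA -subr_eq0 -[X in _ - X]mul1mx -mulmxBl.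
have /submxP[D ->] : (Q *m pinvmx Q - 1%:M <= parity_matrix P B)%MS.
  rewrite -kerQ; apply/sub_kermxP.
  by rewrite mulmxBl -mulmxA mulVpmx // mulmx1 mul1mx subrr.
by rewrite -mulmxA A0 mulmx0.
Qed.


(** Counting [R] as one more, possibly empty, class expresses disjointness and covering in a single
    equation. *)
Definition partitions P R : Prop :=
  (forall f, (count (fun F : {set {set T}} => f \in F) P + (f \in R)
              = (f \in edges e))%N)
  /\ set0 \notin P.

(** * Dimension bound and isometry for labelings of a partition *)

Section Partition.
Hypothesis P_part : partitions P set0.

Lemma sum_mem_cls f : (\sum_(j < size P) (f \in cls j) = (f \in edges e))%N.
Proof.
case: P_part => /(_ f); rewrite inE addn0 => <- _.
rewrite -sum1_count (big_nth set0) big_mkord [RHS]big_mkcond.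
by apply: eq_bigr => j _; rewrite /cls; case: (f \in _).
Qed.

Lemma mem_cls f : f \in edges e -> exists j : 'I_(size P), f \in cls j.
Proof.
move=> fE; apply/existsP; apply: contraTT fE => /existsPn nf.
rewrite -eqb0 -sum_mem_cls; apply/eqP/big1 => j _.
by rewrite (negPf (nf j)).
Qed.

Lemma cls_edges (j : 'I_(size P)) f : f \in cls j -> f \in edges e.
Proof.
move=> fj; have := sum_mem_cls f; rewrite (bigD1 j) //= fj.
by case: (f \in edges e).
Qed.

Lemma cls_unique (i j : 'I_(size P)) f : f \in cls i -> f \in cls j -> i = j.
Proof.
move=> fi fj; apply/eqP/negPn/negP => ij; have := sum_mem_cls f.
rewrite (bigD1 i) //= fi (bigD1 j) /=; last by rewrite eq_sym.
by rewrite fj; case: (f \in edges e).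
Qed.

Lemma sum_cls (V : nmodType) (F : 'I_(size P) -> V) j f :
  f \in cls j -> \sum_(i | f \in cls i) F i = F j.
Proof.
move=> fj; apply: big_pred1 => i; apply/idP/eqP => [fi|->//].
exact: cls_unique fi fj.
Qed.

Lemma cls_neq0 (j : 'I_(size P)) : exists f, f \in cls j.
Proof.
by apply/set0Pn; case: P_part => _; apply: contraNneq => <-; apply: mem_nth.
Qed.

Lemma partitions_size : (size P <= #|edges e|)%N.
Proof.
rewrite -sum1_card -[size P]card_ord -sum1_card.
apply: (@leq_trans (\sum_(j < size P) \sum_(f in cls j) 1)%N).
  by apply: leq_sum => j _; rewrite sum1_card card_gt0; apply/set0Pn/cls_neq0.
rewrite (exchange_big_dep [in edges e]) /=; last by move=> j f _ /cls_edges.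
apply: leq_sum => f fE; have [j fj] := mem_cls fE.
rewrite (big_pred1 j) // => i; apply/idP/eqP => [fi|-> //].
exact: cls_unique fi fj.
Qed.

Lemma generatorsP s :
  reflect (exists2 j, s = g j & g j != 0) (s \in generators g).
Proof.
by apply: (iffP imsetP) => -[j]; [rewrite inE|]; exists j => //; rewrite inE.
Qed.

Lemma walk_word x p : path e x p ->
  exists w : seq 'rV['F_2]_k, [/\ {subset w <= generators g},
    \sum_(s <- w) s = lam x + lam (last x p) & (size w <= size p)%N].
Proof.
elim: p x => [|y p IH] x /=; first by exists [::]; rewrite big_nil F2_addrr.
case/andP=> xy /IH[w [wS sum_w size_w]].
have xyE : [set x; y] \in edges e by apply/edgesP; exists x, y.
have [j xyj] := mem_cls xyE.
have gj : g j = lam x + lam y.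
  by rewrite lam_edge // /edge_label (sum_cls _ xyj).
have sum_gw : g j + \sum_(s <- w) s = lam x + lam (last y p).
  by rewrite gj sum_w addrA -[lam x + lam y + _]addrA F2_addrr addr0.
(* A zero generator is not in the generator set; its letter is dropped, hence only an inequality on
   lengths. *)
have [gj0|gj_neq0] := eqVneq (g j) 0.
  by exists w; rewrite -sum_gw gj0 add0r; split=> //; apply: leqW.
exists (g j :: w); rewrite big_cons; split=> // s.
rewrite inE => /predU1P[->|/wS//].
by apply/generatorsP; exists j.
Qed.

Lemma cayley_dist_le u v d : dist e u v = Some d ->
  exists2 d', dist (cayley (generators g)) (lam u) (lam v) = Some d'
            & (d' <= d)%N.
Proof.
case/distP=> /walk_of_lengthP[p [up <- <-]] _.
have [w [wS sum_w size_w]] := walk_word up.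
have [|d' dist_d' le_d'] := @dist_exists _ (cayley (generators g)) (lam u)
  (lam (last u p)) (size w); last by exists d' => //; apply: leq_trans size_w.
by apply/cayley_walkP; exists w; rewrite sum_w addrA F2_addrr add0r.
Qed.

Lemma quotient_dim_le : (k <= #|T| - 1)%N.
Proof.
case: g_lam => B [Q [root [_ _ /andP[Q_full _] gE lam_last]]].
have lam_root : lam root = 0 := lam_last [::] isT.
move: Q_full; rewrite /row_full => /eqP <-.
have span_lam v : (lam v <= \sum_(v | v != root) <<lam v>>)%MS.
  have [->|v_root] := eqVneq v root; first by rewrite lam_root sub0mx.
  by rewrite (sumsmx_sup v) // genmxE.
apply: (@leq_trans (\rank (\sum_(v | v != root) <<lam v>>)%MS)).
  apply/mxrankS/row_subP=> j; rewrite -gE.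
  have [f fj] := cls_neq0 j; have /edgesP[x [y [xy def_f]]] := cls_edges fj.
  have -> : g j = lam x + lam y.
    by rewrite lam_edge // -def_f /edge_label (sum_cls _ fj).
  by rewrite addmx_sub.
apply: leq_trans (mxrank_sum_leqif _) _.
rewrite /= subn1 -(cardC1 root) -sum1_card; apply: leq_sum => v _.
by rewrite mxrank_gen rank_leq_row.
Qed.

Lemma incidence_functional L : multi_edge_classes P = set0 ->
  exists r : 'cV['F_2]_k,
    forall j f, f \in cls j -> (g j *m r) 0 0 = incidence L f.
Proof.
move=> no_multi.
have cls1 (j : 'I_(size P)) f : f \in cls j -> cls j = [set f].
  move=> fj; apply/eqP; rewrite eq_sym eqEcard sub1set fj cards1 leqNgt.
  by have := in_set0 j; rewrite -no_multi inE => ->.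
have [|r rE] := @functional_lift (fun j => \sum_(f in cls j) incidence L f).
  move=> B even_B; rewrite -[RHS](even_subgraph_incidence L even_B).
  transitivity (\sum_(j < size P) \sum_(f in B | f \in cls j) incidence L f).
    apply: eq_bigr => j _; have [f fj] := cls_neq0 j.
    rewrite (cls1 _ _ fj) big_set1; case fB: (f \in B).
      rewrite (setIidPl _) ?sub1set // cards1 mul1r (big_pred1 f) // => h.
      apply/andP/eqP => [[_ /set1P]|->] //.
      by rewrite fB set11.
    rewrite (_ : _ :&: _ = set0) ?cards0 ?mul0r ?big_pred0 //.
      by move=> h; apply/andP=> -[hB /set1P hf]; rewrite hf fB in hB.
    by apply/setP=> h; rewrite !inE; case: eqP => // ->.
  rewrite (exchange_big_dep [in B]) /=; last by move=> j f _ /andP[].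
  apply: eq_bigr => f fB.
  case/andP: even_B => /subsetP/(_ f fB)/mem_cls[j fj] _.
  rewrite (big_pred1 j) // => i; rewrite fB.
  by apply/idP/eqP => [fi|->//]; apply: cls_unique fi fj.
by exists r => j f fj; rewrite rE (cls1 _ _ fj) big_set1.
Qed.

Lemma word_size_ge u v d (w : seq 'rV['F_2]_k) : multi_edge_classes P = set0 ->
  dist e u v = Some d -> {subset w <= generators g} ->
  \sum_(s <- w) s = lam u + lam v -> (d <= size w)%N.
Proof.
move=> no_multi uv_d wS sum_w.
pose D x := odflt 0%N (dist e u x).
have distD x : dist e u x = Some (D x).
  by have [d' ux_d' _] := dist_conn u x; rewrite /D ux_d'.
have D_edge x y : e x y -> (D y <= (D x).+1)%N.
  move=> xy; have /distP[/walk_of_lengthP[p [up px sp]] _] := distD x.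
  have [|d' ] := @dist_exists _ e u y (D x).+1.
    apply/walk_of_lengthP; exists (rcons p y).
    by rewrite rcons_path up px last_rcons size_rcons sp.
  by rewrite distD => -[->].
have D_u : D u = 0%N.
  have [|d' ] := @dist_exists _ e u u 0%N.
    by apply/walk_of_lengthP; exists [::].
  by rewrite distD => -[->]; rewrite leqn0 => /eqP.
have D_v : D v = d by rewrite /D uv_d.
(* Each of these [d] balls around [u] contains [u] but not [v]. *)
pose L (i : 'I_d) : {set T} := [set x | (D x <= i)%N].
have [r rE] := fin_all_exists (fun i => incidence_functional (L i) no_multi).
pose crosses (s : 'rV['F_2]_k) i := (s *m r i) 0 0 != 0.
have crossed i : has (fun s => crosses s i) w.
  apply: contraT; rewrite -all_predC => /allP nw.
  have /connectP[p up def_v] := e_conn u v.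
  have : ((\sum_(s <- w) s) *m r i) 0 0 = 0.
    rewrite mulmx_suml summxE big_seq big1 // => s /nw.
    by rewrite /= negbK => /eqP.
  rewrite sum_w def_v lam_walk // walk_labelE mulmx_suml summxE.
  have -> : \sum_(f <- walk_edges u p) (edge_label g f *m r i) 0 0
    = \sum_(f <- walk_edges u p) incidence (L i) f.
    rewrite !big_seq; apply: eq_bigr => f /(walk_edges_sub up)/mem_cls[j fj].
    by rewrite /edge_label (sum_cls _ fj) (rE _ _ _ fj).
  rewrite (sum_incidence_walk e_irr) // -def_v !inE D_u D_v.
  by rewrite [(d <= _)%N]leqNgt ltn_ord addr0 => /eqP; rewrite oner_eq0.
(* The ends of an edge have distances from [u] differing by at most one, so the edge crosses the
   boundary of at most one ball. *)
have crosses1 s i i' : s \in w -> crosses s i -> crosses s i' -> i = i'.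
  move=> /wS/generatorsP[j -> _]; have [f fj] := cls_neq0 j.
  rewrite /crosses !(rE _ _ _ fj).
  have /edgesP[x [y [xy ->]]] := cls_edges fj.
  have Dy_le := D_edge _ _ xy; have yx : e y x by rewrite e_sym.
  have Dx_le := D_edge _ _ yx.
  rewrite !(incidence_edge e_irr) // !inE => xi xi'.
  apply/val_inj => /=; move: xi xi'.
  by do 4![case: leqP => ?] => //; lia.
rewrite -[d]card_ord -sum1_card -[size w]sum1_size.
(* Double counting of the pairs of a cut and a letter crossing it. *)
apply: (@leq_trans (\sum_(i < d) \sum_(s <- w) crosses s i)%N).
  apply: leq_sum => i _; have := crossed i; rewrite has_count -sum1_count.
  by rewrite big_mkcond /=; under eq_bigr do rewrite -mulrb natn.
rewrite exchange_big /= big_seq [leqRHS]big_seq; apply: leq_sum => s sw.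
have [/existsP[i si]|/existsPn no_i] := boolP [exists i, crosses s i];
  last first.
  by rewrite big1 // => i _; rewrite (negPf (no_i i)).
rewrite (bigD1 i) //= big1 ?addn0 ?leq_b1 // => i' ii'.
by apply/eqP; rewrite eqb0; apply: contraNN ii' => /(crosses1 _ _ _ sw si) ->.
Qed.

Lemma singletons_isometric : multi_edge_classes P = set0 ->
  isometric e lam (generators g).
Proof.
move=> no_multi u v; have [d uv_d _] := dist_conn u v.
have [d' uv_d' le_d'] := cayley_dist_le uv_d.
rewrite uv_d uv_d'; congr Some; apply/eqP; rewrite eqn_leq le_d' /=.
have /distP[/cayley_walkP[w [wS def_lam <-]] _] := uv_d'.
apply: word_size_ge uv_d wS _ => //.
by rewrite def_lam addrA F2_addrr add0r.
Qed.

End Partition.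
End Labeled.
End QuotientLabeling.

(** * The algorithm *)

Lemma exists_largest (I : finType) (A : {set I}) (F : I -> nat) :
  A != set0 -> exists2 i, i \in A & forall j, j \in A -> (F j <= F i)%N.
Proof. by case/set0Pn=> i0 /(arg_maxnP F)[i iA max_i]; exists i. Qed.

(** * Cliques chosen for the initial partition *)

Section Cliques.
Variables (T : finType) (e : rel T).
Implicit Types (f : {set T}) (R C K L : {set {set T}}).

Lemma phi_clique1 f : phi_clique e [set f].
Proof.
apply/forall_inP=> a /set1P->; apply/forall_inP=> b /set1P->.
by rewrite eqxx.
Qed.

Let grow L f := if phi_clique e (f |: L) then f |: L else L.

Lemma foldl_grow L s : L \subset foldl grow L s
  /\ {subset foldl grow L s <= [predU (mem L) & (mem s)]}.
Proof.
elim: s L => [|f s IH] L /=.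
  by split=> // h hL; rewrite inE hL.
have [sub1 sub2] := IH (grow L f); split.
  apply: subset_trans sub1; rewrite /grow; case: ifP => // _.
  exact: subsetU1.
move=> h /sub2; rewrite !inE /grow; case: ifP => _; last first.
  by case/orP=> ->; rewrite ?orbT.
by rewrite !inE => /orP[/orP[]|] ->; rewrite ?orbT.
Qed.

Lemma phi_components_sub R C :
  C \in phi_components e R -> C \subset R /\ C != set0.
Proof.
case/imsetP=> f fR ->; split; last first.
  by apply/set0Pn; exists f; rewrite inE connect0.
apply/subsetP=> h; rewrite inE => /connectP[p fp ->].
case/lastP: p fp => [//|p l]; rewrite rcons_path last_rcons.
by case/andP=> _ /and3P[].
Qed.

(** Nonemptiness makes the building phase progress: a single edge is a clique, so a maximum clique
    is nonempty and the greedy scan keeps its first edge. *)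
Lemma next_class_sub R K : next_class e R K -> K \subset R /\ K != set0.
Proof.
case=> C [/phi_components_sub[CR C0] _]; case: ifP => [_ -> //|_].
have [f fC] := set0Pn _ C0.
case=> [[KC _ max_K]|[s s_C ->]].
  split; first exact: subset_trans CR.
  have := max_K [set f]; rewrite sub1set fC cards1 phi_clique1 card_gt0.
  exact.
have [_ sub2] := foldl_grow set0 s; split.
  apply/subsetP=> h /sub2; rewrite !inE /= (perm_mem s_C) mem_enum.
  exact: (subsetP CR).
case: s s_C {sub2} => [|h s] s_C.
  by have := perm_mem s_C f; rewrite mem_enum fC.
apply/set0Pn; exists h; have [/subsetP sub1 _] := foldl_grow (grow set0 h) s.
by apply: sub1; rewrite /grow setU0 phi_clique1 set11.
Qed.

Lemma next_class_exists R : R != set0 -> exists K, next_class e R K.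
Proof.
case/set0Pn=> f fR.
have [|C CR max_C] := @exists_largest _ (phi_components e R) (fun C => #|C|).
  by apply/set0Pn; eexists; apply/imsetP; exists f.
exists (if phi_clique e C then C else foldl grow set0 (enum C)), C.
split=> //; case: (phi_clique e C) => //; right.
by exists (enum C).
Qed.

End Cliques.

(** * Invariant, termination and progress *)

Section Algorithm.
Variables (T : finType) (e : rel T).
Hypotheses (e_sym : symmetric e) (e_irr : irreflexive e).
Hypothesis e_conn : forall x y : T, connect e x y.
Implicit Types (f : {set T}) (P : seq {set {set T}}) (R K : {set {set T}}).

(** A value found by the search is exact, and distances in the connected graph are at most [diam e],
    so truncation hides no agreement. *)
Lemma violations0P k (lam : T -> 'rV['F_2]_k) S :
  violations e lam S = set0 <-> isometric e lam S.
Proof.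
split=> [no_viol u v|iso].
  have [d uv_d _] := dist_conn e_conn u v.
  have := in_set0 (u, v); rewrite -no_viol inE /= => /negbFE/eqP.
  rewrite uv_d => /bfs_dist[lam_d _].
  exact: (iffRL (cayley_dist0 _ _ _ _) lam_d).
apply/setP=> -[u v]; rewrite !inE /=; apply/negbTE/negPn/eqP.
have [d uv_d le_d] := dist_conn e_conn u v; have := iso u v.
rewrite uv_d => /(iffLR (cayley_dist0 _ _ _ _)) lam_d.
exact: (iffRL (bfs_dist _ _ _ _ _) (conj lam_d le_d)).
Qed.

Lemma partitions_rcons P R K : partitions e P R -> K \subset R -> K != set0 ->
  partitions e (rcons P K) (R :\: K).
Proof.
move=> [count_P P0] KR K0; split=> [f|].
  rewrite -count_P -cats1 count_cat /= !inE.
  have := subsetP KR f; case: (f \in K) => [->//|_];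
    by rewrite !addn0.
by rewrite mem_rcons inE negb_or eq_sym K0.
Qed.

Lemma size_split_class P (j : 'I_(size P)) f :
  size (split_class j f) = (size P).+1.
Proof. by rewrite size_rcons size_set_nth (maxn_idPr _). Qed.

Lemma partitions_split P (j : 'I_(size P)) f : partitions e P set0 ->
  j \in multi_edge_classes P -> f \in cls j ->
  partitions e (split_class j f) set0.
Proof.
move=> P_part; rewrite inE => multi_j fj; case: (P_part) => count_P P0; split.
  move=> h; have := count_P h.
  rewrite /split_class -cats1 count_cat count_set_nth ltn_ord -/(cls j) /=.
  rewrite in_set0 in_set1 in_setD1 !addn0 muln1 => ->.
  have [->|hf] := eqVneq h f.
    by rewrite fj (cls_edges P_part fj).
  have := @cls_edges _ _ _ P_part j h.
  case: (h \in cls j) => [->//|_]; by case: (h \in edges e).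
rewrite mem_rcons inE negb_or eq_sym -cards_eq0 cards1 /=.
apply/negP=> /(nthP set0)[i]; rewrite size_set_nth (maxn_idPr _) // => iP.
rewrite nth_set_nth /=; case: eqP => [_ split0|_ Pi].
  by move: multi_j; rewrite (cardsD1 f) fj split0 cards0.
by move/negP: P0; apply; rewrite -Pi mem_nth.
Qed.

Lemma class_to_split_multi P k (g : 'I_(size P) -> 'rV['F_2]_k) w j :
  class_to_split g w j -> j \in multi_edge_classes P.
Proof.
rewrite /class_to_split; case: ifP => _ [] //.
by rewrite inE => /andP[].
Qed.

Definition invariant (s : state T) : Prop :=
  match s with
  | Building P R => partitions e P R
  | Repairing P => partitions e P set0
  | Returned k lam gens => isometric e lam gens /\ (k <= #|T| - 1)%N
  end.

(** The constants 2 and 1 make the passages from building to repairing and from repairing to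
    returned strict decreases. *)
Definition variant (s : state T) : nat :=
  match s with
  | Building P R => (#|edges e| + #|R| + 2)%N
  | Repairing P => (#|edges e| - size P + 1)%N
  | Returned _ _ _ => 0%N
  end.

Lemma step_invariant s s' : step e (#|T| - 1) s s' -> invariant s ->
  invariant s' /\ (variant s' < variant s)%N.
Proof.
case=> {s s'}.
- move=> P R K R0 /next_class_sub[KR K0] P_part.
  split; first exact: partitions_rcons.
  rewrite /= ltn_add2r ltn_add2l cardsDS // ltn_subrL card_gt0 K0 /=.
  by rewrite card_gt0.
- by move=> P P_part; split=> //=; lia.
- move=> P k g lam P1 k1 g1 lam1 g_lam k_gt _ _ P_part.
  by have := quotient_dim_le e_conn g_lam P_part; rewrite leqNgt k_gt.
- move=> P k g lam g_lam k_le /violations0P iso P_part.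
  by split=> //=; rewrite addn1.
move=> P k g lam u v w j f g_lam k_le _ _ /class_to_split_multi multi_j fj.
move=> P_part.
have P'_part := partitions_split P_part multi_j fj.
(* The bound on the split partition keeps the truncated subtraction in [variant] from stalling at
   0. *)
split=> //; have := partitions_size P'_part.
rewrite /variant size_split_class; move: #|_| => m.
by lia.
Qed.

Lemma invariant_Acc s :
  invariant s -> Acc (fun s' s => step e (#|T| - 1) s s') s.
Proof.
have [n lt_s] := ubnP (variant s); elim: n s lt_s => [s|n IH s lt_s s_inv].
  by rewrite ltn0.
constructor=> s' st; have [s'_inv lt_s'] := step_invariant st s_inv.
exact: IH (leq_trans lt_s' lt_s) s'_inv.
Qed.

Lemma invariant_progress s : (0 < #|T|)%N -> invariant s ->
  returns s \/ exists s', step e (#|T| - 1) s s'.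
Proof.
move=> T_nonempty; case: s => [P R|P|k lam S] s_inv;
  last by left; exists k, lam, S.
  right; have [->|R0] := eqVneq R set0; first by eexists; apply: StepLoop.
  by have [K RK] := next_class_exists e R0; eexists; apply: StepClass RK.
right; have [k [g [lam g_lam]]] :=
  quotient_labeling_exists e_irr e_conn P T_nonempty.
have k_le := quotient_dim_le e_conn g_lam s_inv.
have [no_viol|] := eqVneq (violations e lam (generators g)) set0.
  by eexists; apply: StepReturn g_lam k_le no_viol.
move=> viol; have [uv0 uv0_viol] := set0Pn _ viol.
have multi : multi_edge_classes P != set0.
  apply: contraNneq viol.
  move/(singletons_isometric e_sym e_irr e_conn g_lam s_inv).
  by move/violations0P->.
have [[u v] uv_viol uv_max] :=
  Order.TotalTheory.arg_maxP (gap e lam (generators g)) uv0_viol.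
have worst : worst_violation e lam (generators g) (u, v) by split.
have [d uv_d _] := dist_conn e_conn u v.
have [d' /(iffLR (cayley_dist0 _ _ _ _)) lam_d' _] :=
  cayley_dist_le e_conn g_lam s_inv uv_d.
(* The letters of a shortest Cayley walk form the geodesic word. *)
have /distP[/cayley_walkP[w [wS def_lam size_w]] _] := lam_d'.
have geo_w : geodesic_word (generators g) (lam u + lam v) w.
  by split=> //; rewrite ?size_w // def_lam add0r.
have [j split_j] : exists j, class_to_split g w j.
  rewrite /class_to_split; case: eqVneq => [_|]; last first.
    by case/(exists_largest (fun j => #|cls j|)) => j; exists j.
  by case/(exists_largest (fun j => #|cls j|)): multi => j; exists j.
have [f fj] := cls_neq0 s_inv j.
by eexists; apply: StepRepair g_lam k_le worst geo_w split_j fj.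
Qed.

Lemma reachable_invariant s : reachable e (#|T| - 1) s -> invariant s.
Proof.
move=> reach; have: invariant (initial_state e).
  by split=> // f; rewrite /= add0n.
elim: reach => {s} [s s' st inv|//|s1 s2 s3 _ IH1 _ IH2 inv1].
  by have [] := step_invariant st inv.
exact/IH2/IH1.
Qed.

End Algorithm.

Theorem theorem2p32 (T : finType) (e : rel T)
  (e_sym : symmetric e) (e_irr : irreflexive e)
  (T_nonempty : (0 < #|T|)%N) (e_conn : forall x y : T, connect e x y) :
  terminates e (#|T| - 1)%N /\
  forall (k : nat) (lam : T -> 'rV['F_2]_k) (S : {set 'rV['F_2]_k}),
    reachable e (#|T| - 1)%N (Returned lam S) ->
    isometric e lam S /\ (k <= #|T| - 1)%N.
Proof.
have reach_inv := reachable_invariant e_conn.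
split; last by move=> k lam S /reach_inv.
split; last first.
  by move=> s /reach_inv; apply: (invariant_progress e_sym e_irr e_conn).
by apply: (invariant_Acc e_conn); split=> // f; rewrite /= add0n.
Qed.
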